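(* Let $r\ge 2$. Suppose $n\ge 1$ is a number such that $C_r(\mathfrak{gl}_m)$ is irreducible for all $1\le m<n$. If $C_r(\mathcal{N}_n)$ is irreducible, then so is $C_r(\mathfrak{gl}_n)$.
   Context: $k$ is an algebraically closed field, $\mathfrak{gl}_m$ is the space of $m\times m$ matrices over $k$ (an affine space with the Zariski topology), and $\mathcal{N}_n\subset\mathfrak{gl}_n$ is the closed subvariety of nilpotent matrices. For a closed subvariety $V\subset\mathfrak{gl}_m$ and $r\ge 2$, $C_r(V)=\{(v_1,\ldots,v_r)\in V^r : [v_i,v_j]=0 \text{ for all } i,j\}$, with the Zariski topology. Irreducibility refers to irreducibility as a topological space. *)

(* Defs.v *)
From mathcomp Require Import all_boot all_order all_algebra.
From mathcomp Require Import boolp classical_sets.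
From mathcomp Require Import mpoly.

Set Implicit Arguments.
Unset Strict Implicit.
Unset Printing Implicit Defensive.

Import GRing.Theory.
Local Open Scope classical_set_scope.
Local Open Scope ring_scope.

(* The affine space gl_m^r, of dimension r * m^2. *)
Notation mxtuple k r m := {ffun 'I_r -> 'M[k]_m}.

(* The r * (m * m) matrix entries of a tuple, as a point of affine space. *)
Definition mxtuple_coord (k : closedFieldType) (r m : nat) (v : mxtuple k r m) :
    'rV[k]_(r * (m * m)) :=
  mxvec (\matrix_(i < r) mxvec (v i)).

Definition zero_locus (k : closedFieldType) (r m : nat)
    (S : set {mpoly k[r * (m * m)]}) : set (mxtuple k r m) :=
  [set v | forall p, S p -> p.@[fun t => mxtuple_coord v 0 t] = 0].

Definition zariski_closed (k : closedFieldType) (r m : nat)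
    (F : set (mxtuple k r m)) : Prop :=
  exists S : set {mpoly k[r * (m * m)]}, F = zero_locus S.

(* Closedness in X for the topology induced on X by the Zariski topology. *)
Definition zariski_closed_in (k : closedFieldType) (r m : nat)
    (X F : set (mxtuple k r m)) : Prop :=
  exists2 Z : set (mxtuple k r m), zariski_closed Z & F = X `&` Z.

(* Irreducible spaces are nonempty by convention. *)
Definition zariski_irreducible (k : closedFieldType) (r m : nat)
    (X : set (mxtuple k r m)) : Prop :=
  X !=set0 /\
  forall F G : set (mxtuple k r m),
    zariski_closed_in X F -> zariski_closed_in X G ->
    X = F `|` G -> F = X \/ G = X.

Definition mx_bracket (k : closedFieldType) (m : nat) (A B : 'M[k]_m) : 'M[k]_m :=
  A *m B - B *m A.

Definition gl (k : closedFieldType) (m : nat) : set 'M[k]_m := setT.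

Definition nilpotent_cone (k : closedFieldType) (n : nat) : set 'M[k]_n :=
  [set A | exists d : nat, A ^+ d = 0].

Definition commuting_variety (k : closedFieldType) (r m : nat)
    (V : set 'M[k]_m) : set (mxtuple k r m) :=
  [set v | (forall i, V (v i)) /\ (forall i j, mx_bracket (v i) (v j) = 0)].

Arguments commuting_variety {k} r {m} V.
Arguments gl : clear implicits.
Arguments nilpotent_cone : clear implicits.

(* Main.v *)
Require Import Defs.
From mathcomp Require Import all_boot all_algebra.
From mathcomp Require Import boolp classical_sets mpoly.

(* Let E_n be the set of tuples (q_1(A), ..., q_r(A)) with A an n x n matrix and
   the q_i polynomials.  As the image of an affine space it has irreducible
   closure, so it suffices that E_n is dense in C_r(gl_n).
   If A has a cyclic vector, then only polynomials in A commute with A.  Hence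
   E_n contains a nonempty open subset of C_r(gl_n), and of C_r(N_n); it is
   therefore dense in either of them as soon as that one is irreducible.
   Given a commuting tuple v, either some v_i has two distinct eigenvalues, and
   then v is a direct sum of commuting tuples of sizes m1, m2 < n, which are
   limits of E_m1 and E_m2; or v is a translate by scalars of a point of
   C_r(N_n), and E_n is invariant under such translations.
   A direct sum of q(A) in E_m1 and s(B) in E_m2 lies in E_n: replacing B by
   B + t and s(X) by s(X - t) one may assume that A and B have disjoint spectra,
   and the Chinese remainder theorem applies. *)

Set Implicit Arguments.
Unset Strict Implicit.
Unset Printing Implicit Defensive.

Import GRing.Theory.
Local Open Scope ring_scope.

(** * Algebras of functions, closed under matrix operations *)

(** Covers both the polynomial functions on tuples and the polynomials in one parameter along a
    line. *)
Definition function_subalgebra (k : nzRingType) (T : Type)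
    (K : (T -> k) -> Prop) : Prop :=
  [/\ forall c, K (fun _ => c),
      forall f g, K f -> K g -> K (fun x => f x + g x)
    & forall f g, K f -> K g -> K (fun x => f x * g x)].

Section FunctionSubalgebra.

Variables (k : comNzRingType) (T : Type) (K : (T -> k) -> Prop).
Hypothesis HK : function_subalgebra K.

Lemma function_subalgebra_sum (I : Type) (s : seq I) (P : pred I)
    (F : I -> T -> k) :
  (forall i, K (F i)) -> K (fun x => \sum_(i <- s | P i) F i x).
Proof.
case: HK => KC KD _ KF; elim: s => [|i s IHs].
  by under eq_fun do rewrite big_nil.
case: (boolP (P i)) => Pi.
  by under eq_fun do rewrite big_cons Pi; apply: KD.
by under eq_fun do rewrite big_cons (negPf Pi).
Qed.

Lemma function_subalgebra_prod (I : Type) (s : seq I) (F : I -> T -> k) :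
  (forall i, K (F i)) -> K (fun x => \prod_(i <- s) F i x).
Proof.
case: HK => KC _ KM KF; elim: s => [|i s IHs].
  by under eq_fun do rewrite big_nil.
by under eq_fun do rewrite big_cons; apply: KM.
Qed.

Lemma function_subalgebra_exp (f : T -> k) (j : nat) :
  K f -> K (fun x => f x ^+ j).
Proof.
case: HK => KC _ KM Kf; elim: j => [|j IHj].
  by under eq_fun do rewrite expr0.
by under eq_fun do rewrite exprS; apply: KM.
Qed.

Lemma function_subalgebra_meval (N : nat) (h : T -> 'I_N -> k)
    (p : {mpoly k[N]}) :
  (forall i, K (h^~ i)) -> K (fun x => p.@[h x]).
Proof.
case: HK => KC _ KM Kh; under eq_fun do rewrite mevalE.
apply: function_subalgebra_sum => m; apply: KM => //.
by apply: function_subalgebra_prod => i; apply: function_subalgebra_exp.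
Qed.

Lemma function_subalgebra_mulmx (m n p : nat) (A : T -> 'M[k]_(m, n))
    (B : T -> 'M[k]_(n, p)) :
  (forall a b, K (fun x => A x a b)) -> (forall a b, K (fun x => B x a b)) ->
  forall a b, K (fun x => (A x *m B x) a b).
Proof.
case: HK => _ _ KM KA KB a b; under eq_fun do rewrite mxE.
by apply: function_subalgebra_sum => j; apply: KM.
Qed.

Lemma function_subalgebra_mx_exp (n j : nat) (A : T -> 'M[k]_n) :
  (forall a b, K (fun x => A x a b)) ->
  forall a b, K (fun x => (A x ^+ j) a b).
Proof.
case: HK => KC _ _ KA; elim: j => [|j IHj] a b.
  by under eq_fun do rewrite expr0 mxE.
by under eq_fun do rewrite exprS; apply: function_subalgebra_mulmx.
Qed.

Lemma function_subalgebra_det (n : nat) (A : T -> 'M[k]_n) :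
  (forall a b, K (fun x => A x a b)) -> K (fun x => \det (A x)).
Proof.
case: HK => KC _ KM KA; apply: function_subalgebra_sum => s.
by apply: KM => //; apply: function_subalgebra_prod.
Qed.

End FunctionSubalgebra.

(** * Polynomial functions on tuples and irreducibility *)

Section PolynomialFunctions.

Variables (k : closedFieldType) (r : nat).

Definition polyfun (m : nat) (f : mxtuple k r m -> k) : Prop :=
  exists p : {mpoly k[r * (m * m)]},
    f = fun v => p.@[fun t => mxtuple_coord v 0 t].

Lemma polyfun_subalgebra (m : nat) : function_subalgebra (@polyfun m).
Proof.
split=> [c|f g [p ->] [q ->]|f g [p ->] [q ->]].
- by exists c%:MP; apply/funext => v; rewrite mevalC.
- by exists (p + q); apply/funext => v; rewrite mevalD.
- by exists (p * q); apply/funext => v; rewrite mevalM.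
Qed.

Lemma polyfun_entry (m : nat) (i : 'I_r) (a b : 'I_m) :
  polyfun (fun v : mxtuple k r m => v i a b).
Proof.
exists 'X_(mxvec_index i (mxvec_index a b)); apply/funext => v.
by rewrite mevalXU /mxtuple_coord mxvecE mxE mxvecE.
Qed.

(** Sums and products of the entries of [phi] give every polynomial in them. Later [phi] is a line,
    a translation or a direct sum. *)
Lemma function_subalgebra_polyfun (T : Type) (K : (T -> k) -> Prop) (m : nat)
    (phi : T -> mxtuple k r m) (f : mxtuple k r m -> k) :
  function_subalgebra K ->
  (forall i a b, K (fun x => phi x i a b)) -> polyfun f ->
  K (fun x => f (phi x)).
Proof.
move=> HK Kphi [p ->].
apply: (@function_subalgebra_meval _ _ _ HK _
  (fun x t => mxtuple_coord (phi x) 0 t)) => t.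
case/mxvec_indexP: t => i t; case/mxvec_indexP: t => a b.
by under eq_fun do rewrite /mxtuple_coord mxvecE mxE mxvecE.
Qed.

(** Closed sets are intersections of hypersurfaces, so irreducibility can be tested on pairs of
    hypersurfaces: the ideal of [X] is prime. *)
Lemma zariski_irreducible_polyfunP (m : nat) (X : set (mxtuple k r m)) :
  zariski_irreducible X <->
  (X !=set0)%classic /\
  forall f g : mxtuple k r m -> k, polyfun f -> polyfun g ->
    (forall v, X v -> f v * g v = 0) ->
    (forall v, X v -> f v = 0) \/ (forall v, X v -> g v = 0).
Proof.
split=> -[X0 HX]; split=> //.
  move=> f g [p fE] [q gE] fg0.
  pose Z (h : {mpoly k[r * (m * m)]}) := zero_locus [set h]%classic.
  have Zcl h : zariski_closed_in X (X `&` Z h)%classic.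
    by exists (Z h) => //; exists [set h]%classic.
  have ZP h v : Z h v -> h.@[fun t => mxtuple_coord v 0 t] = 0.
    by move=> /(_ h erefl).
  have ZU : X = ((X `&` Z p) `|` (X `&` Z q))%classic.
    apply/seteqP; split=> [v Xv|v [[]|[]] //].
    have /eqP := fg0 v Xv; rewrite mulf_eq0 fE gE => /orP[]/eqP h0.
      by left; split=> // _ ->.
    by right; split=> // _ ->.
  case: (HX _ _ (Zcl p) (Zcl q) ZU) => XE; [left|right] => v.
    by rewrite -XE fE => -[_ /ZP].
  by rewrite -XE gE => -[_ /ZP].
move=> F G [Y [S ->] FE] [Z [S' ->] GE] XE.
(* A proper closed subset of [X] lies in a hypersurface that does not contain [X]. *)
have outside W (U : set {mpoly k[r * (m * m)]}) :
    W = (X `&` zero_locus U)%classic -> W <> X ->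
    exists2 p, (forall v, W v -> p.@[fun t => mxtuple_coord v 0 t] = 0) &
      exists2 v, X v & p.@[fun t => mxtuple_coord v 0 t] <> 0.
  move=> WE WX; apply: contrapT => none; apply: WX.
  apply/seteqP; split=> v; rewrite WE; first by case.
  move=> Xv; split=> // p Up.
  apply: contrapT => pv; apply: none; exists p; last by exists v.
  by move=> w; rewrite WE => -[_ /(_ p Up)].
case: (pselect (F = X)) => [|FX]; first by left.
case: (pselect (G = X)) => [|GX]; first by right.
have [p pF [v Xv pv]] := outside _ _ FE FX.
have [q qG [w Xw qw]] := outside _ _ GE GX.
have [||u|/(_ v Xv) //|/(_ w Xw) //] := HX
  (fun v => p.@[fun t => mxtuple_coord v 0 t])
  (fun v => q.@[fun t => mxtuple_coord v 0 t]); first by exists p.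
  by exists q.
by rewrite {1}XE => -[/pF ->|/qG ->]; rewrite ?mul0r ?mulr0.
Qed.

(** Nonempty open subsets of an irreducible space are dense: [f * g] vanishes on [X], while [g] does
    not. *)
Lemma polyfun_eq0_dense (m : nat) (X : set (mxtuple k r m))
    (v0 : mxtuple k r m) (f g : mxtuple k r m -> k) :
  zariski_irreducible X -> polyfun f -> polyfun g ->
  X v0 -> g v0 != 0 -> (forall v, X v -> g v != 0 -> f v = 0) ->
  forall v, X v -> f v = 0.
Proof.
case/zariski_irreducible_polyfunP=> _ HX pf pg Xv0 gv0 fg.
case: (HX f g pf pg) => // [v Xv|g0].
  by have [->|/(fg v Xv) ->] := eqVneq (g v) 0; rewrite ?mulr0 ?mul0r.
by rewrite g0 ?eqxx in gv0.
Qed.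

End PolynomialFunctions.

(** * Tuples of polynomials in one matrix, and cyclic vectors *)

Section PolynomialTuples.

Variables (k : closedFieldType) (r : nat).

Definition polynomial_tuple (n : nat) (v : mxtuple k r n.+1) : Prop :=
  exists (A : 'M[k]_n.+1) (q : 'I_r -> {poly k}),
    forall i, v i = horner_mx A (q i).

Lemma horner_mx_coef (n : nat) (A : 'M[k]_n.+1) (q : {poly k}) :
  horner_mx A q = \sum_(i < size q) q`_i *: A ^+ i.
Proof.
rewrite -[in LHS](coefK q) poly_def linear_sum /=.
by apply: eq_bigr => i _; rewrite linearZ /= rmorphXn /= horner_mx_X.
Qed.

Definition polyfun1 (f : k -> k) : Prop := exists p : {poly k}, f = horner p.

Lemma polyfun1_subalgebra : function_subalgebra polyfun1.
Proof.
split=> [c|f g [p ->] [q ->]|f g [p ->] [q ->]].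
- by exists c%:P; apply/funext => t; rewrite hornerC.
- by exists (p + q); apply/funext => t; rewrite hornerD.
- by exists (p * q); apply/funext => t; rewrite hornerM.
Qed.

(* Tuples q(A) are parametrized by the affine space of pairs (A, q), so two of
   them are joined by the image of a line. *)
Lemma polynomial_tuple_ideal_prime (n : nat) (f g : mxtuple k r n.+1 -> k) :
  polyfun f -> polyfun g ->
  (forall v, polynomial_tuple v -> f v * g v = 0) ->
  (forall v, polynomial_tuple v -> f v = 0) \/
  (forall v, polynomial_tuple v -> g v = 0).
Proof.
move=> pf pg fg0; apply: contrapT => /not_orP[].
move=> /existsNP[v /not_implyP[[A [q vE]] /eqP fv]].
move=> /existsNP[w /not_implyP[[B [s wE]] /eqP gw]].
pose line (t : k) : mxtuple k r n.+1 :=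
  [ffun i => horner_mx (A + t *: (B - A)) (q i + t *: (s i - q i))].
have [KC KD KM] := polyfun1_subalgebra.
have KX : polyfun1 id.
  by exists 'X; apply/funext => t; rewrite hornerX.
(* Evaluation at a matrix is linear in the polynomial, and the powers of [A + t *: (B - A)] have
   entries polynomial in [t]. *)
have line_poly i a b : polyfun1 (fun t => line t i a b).
  have Khorner (p : {poly k}) :
      polyfun1 (fun t => horner_mx (A + t *: (B - A)) p a b).
    under eq_fun do rewrite horner_mx_coef summxE.
    apply: (function_subalgebra_sum polyfun1_subalgebra) => j.
    under eq_fun do rewrite mxE.
    apply: (KM) => //; apply: (function_subalgebra_mx_exp polyfun1_subalgebra).
    move=> {}a {}b; under eq_fun do rewrite !mxE.
    by apply: (KD) => //; apply: (KM).
  under eq_fun do rewrite ffunE linearD linearZ /= !mxE.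
  by apply: (KD) => //; apply: (KM).
have [P PE] := function_subalgebra_polyfun polyfun1_subalgebra line_poly pf.
have [Q QE] := function_subalgebra_polyfun polyfun1_subalgebra line_poly pg.
have line0 : line 0 = v by apply/ffunP => i; rewrite ffunE !scale0r !addr0 vE.
have line1 : line 1 = w.
  by apply/ffunP => i; rewrite ffunE !scale1r ![_ + (_ - _)]addrC !subrK wE.
have P0 : P != 0.
  by apply: contra_neq fv => P0; rewrite -line0 (congr1 (@^~ 0) PE) P0 horner0.
have Q0 : Q != 0.
  by apply: contra_neq gw => Q0; rewrite -line1 (congr1 (@^~ 1) QE) Q0 horner0.
(* At a [t] that is not a root of [P * Q], the product of [f] and [g] is nonzero on a polynomial
   tuple. *)
have /closed_nonrootP[t] : P * Q != 0 by rewrite mulf_neq0.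
case/negP; apply/eqP; rewrite hornerM -PE -QE fg0 //.
exists (A + t *: (B - A)), (fun i => q i + t *: (s i - q i)) => i.
by rewrite ffunE.
Qed.

(** Row [i] is e_0 A^i, with e_0 the first basis row vector; invertibility means that e_0 is cyclic
    for [A]. *)
Definition krylov (n : nat) (A : 'M[k]_n.+1) : 'M[k]_n.+1 :=
  \matrix_(i, j) (A ^+ i) 0 j.

Lemma row_krylov (n : nat) (A : 'M[k]_n.+1) (i : 'I_n.+1) :
  row i (krylov A) = row 0 (A ^+ i).
Proof. by apply/rowP => j; rewrite !mxE. Qed.

(** Expanding e_0 B in the basis e_0 A^i gives p with e_0 B = e_0 p(A). Then B - p(A) kills e_0 and
    commutes with A, so it kills the whole basis. *)
Lemma krylov_unitmx_commutant (n : nat) (A B : 'M[k]_n.+1) :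
  krylov A \in unitmx -> comm_mx A B -> exists q, B = horner_mx A q.
Proof.
move=> AU AB; pose c := row 0 B *m invmx (krylov A).
exists (\sum_(i < n.+1) c 0 i *: 'X^i).
set p := \sum_(i < _) _; apply/eqP; rewrite -subr_eq0; apply/eqP.
set D := B - _.
have D0 : row 0 D = 0.
  rewrite linearB /= -[row 0 B](mulmxKV AU) -/c mulmx_sum_row.
  rewrite /p !linear_sum /= -big_split big1 // => i _.
  rewrite !linearZ /= rmorphXn /= horner_mx_X row_krylov -scalerDr.
  by rewrite subrr scaler0.
have AD : comm_mx A D.
  by apply: comm_mxB => //; apply: comm_mx_horner; apply: comm_mx_refl.
rewrite -(mulKmx AU D).
suff -> : krylov A *m D = 0 by rewrite mulmx0.
apply/row_matrixP => i; rewrite row_mul row_krylov -row_mul row0.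
have -> : A ^+ i *m D = D *m A ^+ i.
  exact/commr_sym/commrX/commr_sym.
by rewrite row_mul D0 mul0mx.
Qed.

(** The nilpotent Jordan block, which sends e_i to e_(i+1), so that e_0 is cyclic. *)
Definition shift_mx (n : nat) : 'M[k]_n.+1 :=
  \matrix_(i, j) (j == i.+1 :> nat)%:R.

Lemma shift_mxX (n e : nat) (i j : 'I_n.+1) :
  (shift_mx n ^+ e) i j = (j == i + e :> nat)%N%:R.
Proof.
elim: e i j => [|e IHe] i j.
  by rewrite expr0 mxE addn0 -val_eqE /= eq_sym.
rewrite exprSr mxE; case: (posnP j) => [j0|j_gt0].
  rewrite big1 => [|l _]; first by rewrite j0 addnS.
  by rewrite [X in _ * X]mxE j0 mulr0.
have lt_j : (j.-1 < n.+1)%N by rewrite (leq_ltn_trans (leq_pred j)).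
rewrite (bigD1 (Ordinal lt_j)) //= big1 => [|l lj].
  rewrite addr0 IHe !mxE /= prednK // eqxx mulr1 addnS.
  by rewrite -[in RHS](prednK j_gt0).
rewrite [X in _ * X]mxE; case: eqP => [jl|]; last by rewrite mulr0.
by case/eqP: lj; apply/val_inj; rewrite /= jl.
Qed.

Lemma shift_mx_nilpotent (n : nat) : shift_mx n ^+ n.+1 = 0.
Proof.
apply/matrixP => i j; rewrite shift_mxX mxE.
by rewrite ltn_eqF // (leq_trans (ltn_ord j)) // leq_addl.
Qed.

Lemma krylov_shift_mx (n : nat) : krylov (shift_mx n) = 1%:M.
Proof.
by apply/matrixP => i j; rewrite mxE shift_mxX mxE add0n eq_sym val_eqE.
Qed.

(** Where e_0 is cyclic for [v i0], all [v i] are polynomials in [v i0]. This open condition holds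
    at the tuple made of the Jordan block and zeros. *)
Lemma polynomial_tuple_dense (n : nat) (X : set (mxtuple k r n.+1)) (i0 : 'I_r)
    (f : mxtuple k r n.+1 -> k) :
  zariski_irreducible X -> (X `<=` commuting_variety r (gl k n.+1))%classic ->
  X [ffun i => if i == i0 then shift_mx n else 0] -> polyfun f ->
  (forall v, polynomial_tuple v -> f v = 0) -> forall v, X v -> f v = 0.
Proof.
move=> Xirr XC XJ pf f0.
pose g (v : mxtuple k r n.+1) := \det (krylov (v i0)).
apply: (polyfun_eq0_dense (g := g) Xirr pf _ XJ).
- apply: (function_subalgebra_det (@polyfun_subalgebra k r n.+1)) => a b.
  under eq_fun do rewrite mxE.
  apply: (function_subalgebra_mx_exp (@polyfun_subalgebra k r n.+1)).
  exact: polyfun_entry.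
- by rewrite /g ffunE eqxx krylov_shift_mx det1 oner_eq0.
- move=> v /XC[_ vC] gv; apply: f0; exists (v i0).
  have vU : krylov (v i0) \in unitmx by rewrite unitmxE unitfE.
  have /choice[q qE] i : exists q, v i = horner_mx (v i0) q.
    by apply: krylov_unitmx_commutant => //; apply/subr0_eq/vC.
  by exists q.
Qed.

End PolynomialTuples.

(** * Direct sums of polynomial tuples *)

(** The second polynomial has roots y + t for y an eigenvalue of [B], so [t] has to avoid the
    finitely many differences x - y, which are the roots of [d]. *)
Lemma coprime_char_poly_shift (k : closedFieldType) (m n : nat)
    (A : 'M[k]_m) (B : 'M[k]_n) :
  exists t : k, coprimep (char_poly A) (char_poly B \Po ('X - t%:P)).
Proof.
have [a aE] := closed_field_poly_normal (char_poly A).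
have [b bE] := closed_field_poly_normal (char_poly B).
move: aE bE; rewrite !(monicP (char_poly_monic _)) !scale1r => aE bE.
pose d := \prod_(x <- a) \prod_(y <- b) ('X - (x - y)%:P).
have /closed_nonrootP[t dt] : d != 0.
  apply/monic_neq0/monic_prod => x _; apply: monic_prod => y _.
  exact: monicXsubC.
exists t; apply: Pdiv.ClosedField.root_coprimep => x.
rewrite aE bE root_prod_XsubC => ax; apply: contra dt.
rewrite horner_comp -/(root _ _) root_prod_XsubC !hornerE => bxt.
rewrite /root horner_prod prodf_seq_eq0; apply/hasP; exists x => //=.
rewrite horner_prod prodf_seq_eq0; apply/hasP; exists (x - t) => //=.
by rewrite !hornerE subKr subrr.
Qed.

Lemma horner_mx_translate (k : comNzRingType) (n : nat) (B : 'M[k]_n.+1) (t : k)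
    (p : {poly k}) :
  horner_mx (B + t%:M) (p \Po ('X - t%:P)) = horner_mx B p.
Proof.
elim/poly_ind: p => [|p c IHp]; first by rewrite comp_poly0 !rmorph0.
rewrite comp_polyD comp_polyM comp_polyX comp_polyC !rmorphD !rmorphM /= IHp.
by rewrite rmorphB /= !horner_mx_X !horner_mx_C addrK.
Qed.

Section DirectSum.

Variables (k : closedFieldType) (r n m1 m2 : nat).
Variables (U : 'M[k]_(m1.+1, n.+1)) (U' : 'M[k]_(n.+1, m1.+1)).
Variables (W : 'M[k]_(m2.+1, n.+1)) (W' : 'M[k]_(n.+1, m2.+1)).
Hypotheses (UU' : U *m U' = 1%:M) (WW' : W *m W' = 1%:M).
Hypotheses (UW' : U *m W' = 0) (WU' : W *m U' = 0).
Hypothesis U'U_W'W : U' *m U + W' *m W = 1%:M.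

(** By the hypotheses [row_mx U' W'] is inverse to [col_mx U W], so this is the block diagonal
    matrix of [A] and [B] in another basis, written without a cast between sizes. *)
Definition mx_sum (A : 'M[k]_m1.+1) (B : 'M[k]_m2.+1) : 'M[k]_n.+1 :=
  U' *m A *m U + W' *m B *m W.

Lemma mx_sumM (A A' : 'M[k]_m1.+1) (B B' : 'M[k]_m2.+1) :
  mx_sum (A *m A') (B *m B') = mx_sum A B *m mx_sum A' B'.
Proof.
rewrite /mx_sum mulmxDl !mulmxDr !mulmxA.
rewrite -[_ *m U *m U']mulmxA UU' -[_ *m U *m W']mulmxA UW'.
rewrite -[_ *m W *m U']mulmxA WU' -[_ *m W *m W']mulmxA WW'.
by rewrite !mulmx1 !mulmx0 !mul0mx addr0 add0r.
Qed.

Lemma horner_mx_sum (A : 'M[k]_m1.+1) (B : 'M[k]_m2.+1) (p : {poly k}) :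
  horner_mx (mx_sum A B) p = mx_sum (horner_mx A p) (horner_mx B p).
Proof.
elim/poly_ind: p => [|p c IHp].
  by rewrite !rmorph0 /mx_sum !mulmx0 !mul0mx addr0.
rewrite !rmorphD !rmorphM /= !horner_mx_X !horner_mx_C IHp.
rewrite -[_ * mx_sum _ _]mx_sumM /mx_sum !mulmxDr !mulmxDl !mul_mx_scalar.
rewrite -!scalemxAl addrACA; congr (_ + _).
by rewrite -scalerDr U'U_W'W scalemx1.
Qed.

Definition tuple_sum (a : mxtuple k r m1.+1) (b : mxtuple k r m2.+1) :
    mxtuple k r n.+1 :=
  [ffun i => mx_sum (a i) (b i)].

Lemma polynomial_tuple_sum (a : mxtuple k r m1.+1) (b : mxtuple k r m2.+1) :
  polynomial_tuple a -> polynomial_tuple b ->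
  polynomial_tuple (tuple_sum a b).
Proof.
move=> [A [q aE]] [B [s bE]].
have [t /Bezout_eq1_coprimepP[[u w] /= uw1]] := coprime_char_poly_shift A B.
set cA := char_poly A in uw1; set cB := _ \Po _ in uw1.
have hA : horner_mx A cA = 0 by exact: Cayley_Hamilton.
have hB : horner_mx (B + t%:M) cB = 0.
  by rewrite horner_mx_translate Cayley_Hamilton.
exists (mx_sum A (B + t%:M)).
(* Chinese remainders: [w * cB] is 1 modulo [cA] and 0 modulo [cB], and [u * cA] the reverse. *)
exists (fun i => q i * (w * cB) + (s i \Po ('X - t%:P)) * (u * cA)) => i.
rewrite ffunE horner_mx_sum aE bE; congr mx_sum.
  rewrite -[in LHS](mulr1 (q i)) -uw1 mulrDr !(rmorphD, rmorphM) /= hA.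
  by rewrite !mulr0 addr0 add0r.
rewrite -(horner_mx_translate B t) -[in LHS](mulr1 (s i \Po _)) -uw1 mulrDr.
by rewrite !(rmorphD, rmorphM) /= hB !mulr0 addr0 add0r.
Qed.

(** Either summand can be held constant while the other varies. *)
Lemma polyfun_tuple_sum (T : Type) (K : (T -> k) -> Prop)
    (a : T -> mxtuple k r m1.+1) (b : T -> mxtuple k r m2.+1)
    (f : mxtuple k r n.+1 -> k) :
  function_subalgebra K ->
  (forall i x y, K (fun t => a t i x y)) ->
  (forall i x y, K (fun t => b t i x y)) ->
  polyfun f -> K (fun t => f (tuple_sum (a t) (b t))).
Proof.
move=> HK Ka Kb; have [KC KD KM] := HK.
apply: (function_subalgebra_polyfun HK) => i x y.
under eq_fun do rewrite ffunE mxE.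
by apply: (KD); do 2!apply: (function_subalgebra_mulmx HK) => // *.
Qed.

End DirectSum.

(** * Splitting a commuting tuple *)

(* Splits k^n along a factorization of the characteristic polynomial of some
   v_i into (X - c)^j, for an eigenvalue c, and a cofactor prime to it. *)
Lemma commuting_tuple_split (k : closedFieldType) (r n : nat)
    (v : mxtuple k r n.+1) :
  (forall i j, comm_mx (v i) (v j)) ->
  (exists c : 'I_r -> k, forall i, (v i - (c i)%:M) ^+ n.+1 = 0) \/
  exists m1 m2 (U : 'M[k]_(m1.+1, n.+1)) (U' : 'M[k]_(n.+1, m1.+1))
      (W : 'M[k]_(m2.+1, n.+1)) (W' : 'M[k]_(n.+1, m2.+1)),
    [/\ (m1.+1 + m2.+1 = n.+1)%N,
        [/\ U *m U' = 1%:M, W *m W' = 1%:M, U *m W' = 0, W *m U' = 0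
          & U' *m U + W' *m W = 1%:M],
        (forall i, U *m v i *m W' = 0) & forall i, W *m v i *m U' = 0].
Proof.
move=> vC.
case: (pselect (exists i (p q : {poly k}), [/\ char_poly (v i) = p * q,
  coprimep p q, (exists x, root p x) & exists x, root q x])); last first.
  move=> nosplit; left.
  suff /choice[c cE] i : exists c, (v i - c%:M) ^+ n.+1 = 0 by exists c.
  have /closed_rootP[c rc] : size (char_poly (v i)) != 1%N.
    by rewrite size_char_poly.
  exists c.
  have [j [q]] := multiplicity_XsubC (char_poly (v i)) c.
  rewrite (monic_neq0 (char_poly_monic _)) /= => qc pE.
  (* A nonconstant cofactor [q] would have a root and give a forbidden factorization. If [q] is
     constant, the degree forces [j = n.+1], and Cayley-Hamilton applies. *)
  have [sq|/closed_rootP qr] := eqVneq (size q) 1%N; last first.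
    case: nosplit; exists i, (('X - c%:P) ^+ j), q; split=> //.
    - by rewrite mulrC.
    - by rewrite coprimep_expl // coprimep_sym coprimep_XsubC.
    - exists c; move: rc; rewrite pE rootM (negPf qc) //=.
  have jE : j = n.+1.
    have := size_char_poly (v i).
    rewrite pE size_Mmonic ?monic_exp ?monicXsubC //.
      by rewrite sq size_exp_XsubC => -[].
    by rewrite -size_poly_gt0 sq.
  have /size_poly1P[e e0 qE] : size q == 1%N by rewrite sq.
  have := Cayley_Hamilton (v i); rewrite pE qE jE !rmorphM rmorphXn rmorphB /=.
  rewrite horner_mx_X !horner_mx_C -[_ * _]/(_ *m _) mul_scalar_mx.
  by move/eqP; rewrite scaler_eq0 (negPf e0) => /eqP.
move=> [i0 [p [q [pq cpq [x px] [y qy]]]]]; right.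
set P := kermxpoly (v i0) p; set Q := kermxpoly (v i0) q.
have PQ1 : (P + Q :=: 1%:M)%MS.
  apply: eqmx_trans (eqmx_sym (kermxpolyM _ cpq)) _.
  by rewrite -pq; apply: kermxpoly_min; exact: mxminpoly_dvd_char.
(* The eigenspace of a root [z] of [s] lies in the kernel of [s]; both summands are thus nonzero. *)
have rank0 s z : s %| char_poly (v i0) -> root s z ->
    (0 < \rank (kermxpoly (v i0) s))%N.
  move=> sv sz; rewrite lt0n mxrank_eq0.
  have : eigenvalue (v i0) z.
    rewrite eigenvalue_root_char; case/dvdpP: sv => u ->.
    by rewrite rootM sz orbT.
  apply: contraNneq => s0; rewrite -submx0 -s0 eigenspace_poly.
  move: sz; rewrite root_factor_theorem => /dvdpP[u ->].
  rewrite mulrC /kermxpoly rmorphM /=; apply/sub_kermxP.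
  by rewrite mulmxA mulmx_ker mul0mx.
have [P0 Q0] : (0 < \rank P /\ 0 < \rank Q)%N.
  split; first by apply: (rank0 p x) => //; rewrite pq dvdp_mulr.
  by apply: (rank0 q y) => //; rewrite pq dvdp_mull.
have rkPQ : (\rank P + \rank Q = n.+1)%N.
  by rewrite -mxrank_disjoint_sum ?PQ1 ?mxrank1 ?mxdirect_kermxpoly.
have [m1 m1E] : exists m, \rank P = m.+1.
  by exists (\rank P).-1; rewrite prednK.
have [m2 m2E] : exists m, \rank Q = m.+1.
  by exists (\rank Q).-1; rewrite prednK.
have [U UP] : exists U : 'M[k]_(m1.+1, n.+1), (U :=: P)%MS.
  by rewrite -m1E; exists (row_base P); apply: eq_row_base.
have [W WQ] : exists W : 'M[k]_(m2.+1, n.+1), (W :=: Q)%MS.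
  by rewrite -m2E; exists (row_base Q); apply: eq_row_base.
(* A basis adapted to the splitting. Its two dimensions agree only by a proved equation, so its
   inverse is taken as [pinvmx], which is two-sided because [M] has full rank. *)
pose M := col_mx U W.
have rkM : \rank M = n.+1.
  by rewrite -addsmxE (adds_eqmx UP WQ) PQ1 mxrank1.
have Mfree : row_free M by rewrite /row_free rkM -m1E -m2E rkPQ.
have Mfull : row_full M by rewrite /row_full rkM.
pose U' := lsubmx (pinvmx M); pose W' := rsubmx (pinvmx M).
have := mulmxVp Mfree; have := mulVpmx Mfull.
rewrite -(hsubmxK (pinvmx M)) -/U' -/W' /M mul_row_col mul_col_row.
rewrite scalar_mx_block => UW1 /eq_block_mx[UU' UW' WU' WW'].
exists m1, m2, U, U', W, W'; split=> // [|i|i].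
- by rewrite -m1E -m2E.
(* Kernels of polynomials in [v i0] are stable under every [v i], which commutes with [v i0]. *)
- have /submxP[X XE] : (U *m v i <= U)%MS.
    rewrite UP (eqmxMr _ UP); apply: comm_mx_stable_kermxpoly; exact: vC.
  by rewrite XE -mulmxA UW' mulmx0.
- have /submxP[X XE] : (W *m v i <= W)%MS.
    rewrite WQ (eqmxMr _ WQ); apply: comm_mx_stable_kermxpoly; exact: vC.
  by rewrite XE -mulmxA WU' mulmx0.
Qed.

(** * Density of polynomial tuples in the commuting varieties *)

Section Density.

Variables (k : closedFieldType) (r : nat) (i0 : 'I_r).

Lemma commuting_glP (n : nat) (v : mxtuple k r n) :
  commuting_variety r (gl k n) v <-> forall i j, comm_mx (v i) (v j).
Proof.
split=> [[_ vC] i j|vC]; first exact/subr0_eq/vC.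
by split=> // i j; apply/eqP; rewrite subr_eq0; apply/eqP/vC.
Qed.

Lemma commuting_variety_shift (n : nat) (V : set 'M[k]_n.+1) :
  V (shift_mx k n) -> V 0 ->
  commuting_variety r V [ffun i => if i == i0 then shift_mx k n else 0].
Proof.
move=> VJ V0; split=> [i|i j]; rewrite !ffunE; first by case: eqP.
by do 2![case: eqP => _]; rewrite /mx_bracket ?mulmx0 ?mul0mx subrr.
Qed.

Lemma commuting_gl_dense (n : nat) (f : mxtuple k r n.+1 -> k) :
  zariski_irreducible (commuting_variety r (gl k n.+1)) -> polyfun f ->
  (forall v, polynomial_tuple v -> f v = 0) ->
  forall v, commuting_variety r (gl k n.+1) v -> f v = 0.
Proof.
move=> Cirr; apply: (polynomial_tuple_dense (i0 := i0) Cirr) => //.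
exact: commuting_variety_shift.
Qed.

Lemma commuting_nilpotent_dense (n : nat) (f : mxtuple k r n.+1 -> k) :
  zariski_irreducible (commuting_variety r (nilpotent_cone k n.+1)) ->
  polyfun f -> (forall v, polynomial_tuple v -> f v = 0) ->
  forall v, commuting_variety r (nilpotent_cone k n.+1) v -> f v = 0.
Proof.
move=> Cirr; apply: (polynomial_tuple_dense (i0 := i0) Cirr) => [v [_ vC]|] //.
apply: commuting_variety_shift; first by exists n.+1; apply: shift_mx_nilpotent.
by exists 1%N; rewrite expr1.
Qed.

Lemma commuting_gl_dense_step (n : nat) (f : mxtuple k r n.+1 -> k) :
  (forall m, (m < n)%N ->
    zariski_irreducible (commuting_variety r (gl k m.+1))) ->
  zariski_irreducible (commuting_variety r (nilpotent_cone k n.+1)) ->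
  polyfun f -> (forall v, polynomial_tuple v -> f v = 0) ->
  forall v, commuting_variety r (gl k n.+1) v -> f v = 0.
Proof.
move=> IH Nirr pf f0 v /commuting_glP vC.
have [[c vc]|] := commuting_tuple_split vC.
  (* Translating by the scalars [c i] moves the question for [v] to a point of the nilpotent
     commuting variety. *)
  pose h (w : mxtuple k r n.+1) := f [ffun i => w i + (c i)%:M].
  have ph : polyfun h.
    have HK := polyfun_subalgebra k r n.+1; have [KC KD KM] := HK.
    apply: (function_subalgebra_polyfun HK) => // i x y.
    under eq_fun do rewrite ffunE mxE; apply: (KD) => //.
    exact: polyfun_entry.
  have h0 w : polynomial_tuple w -> h w = 0.
    move=> [A [q wE]]; apply: f0; exists A, (fun i => q i + (c i)%:P) => i.
    by rewrite ffunE wE rmorphD /= horner_mx_C.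
  have -> : v = [ffun i => [ffun j => v j - (c j)%:M] i + (c i)%:M].
    by apply/ffunP => i; rewrite !ffunE subrK.
  apply: (commuting_nilpotent_dense Nirr ph h0); split=> [i|i j].
    by exists n.+1; rewrite ffunE; apply: vc.
  rewrite !ffunE; apply/eqP; rewrite subr_eq0; apply/eqP.
  apply: comm_mxB; last exact: comm_mx_scalar.
  by apply/comm_mx_sym/comm_mxB; [exact: vC | exact: comm_mx_scalar].
move=> [m1 [m2 [U [U' [W [W' [mn [UU WW UW WU UW1] Uv Wv]]]]]]].
pose a : mxtuple k r m1.+1 := [ffun i => U *m v i *m U'].
pose b : mxtuple k r m2.+1 := [ffun i => W *m v i *m W'].
have vE : v = tuple_sum U U' W W' a b.
  apply/ffunP => i; rewrite !ffunE /mx_sum -[LHS]mul1mx -[LHS]mulmx1 -UW1.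
  rewrite !mulmxDl !mulmxDr !mulmxA.
  have -> : U' *m U *m v i *m W' = 0 by rewrite -!mulmxA (mulmxA U) Uv mulmx0.
  have -> : W' *m W *m v i *m U' = 0 by rewrite -!mulmxA (mulmxA W) Wv mulmx0.
  by rewrite !mul0mx addr0 add0r.
(* The row space of [U] is stable under [v i], so the blocks of commuting matrices commute. *)
have UvU i : U *m v i *m U' *m U = U *m v i.
  by rewrite -[RHS]mulmx1 -UW1 mulmxDr !mulmxA Uv mul0mx addr0.
have WvW i : W *m v i *m W' *m W = W *m v i.
  by rewrite -[RHS]mulmx1 -UW1 mulmxDr !mulmxA Wv mul0mx add0r.
have aC : commuting_variety r (gl k m1.+1) a.
  apply/commuting_glP => i j; rewrite !ffunE /comm_mx !mulmxA !UvU.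
  by rewrite -![U *m _ *m _]mulmxA vC.
have bC : commuting_variety r (gl k m2.+1) b.
  apply/commuting_glP => i j; rewrite !ffunE /comm_mx !mulmxA !WvW.
  by rewrite -![W *m _ *m _]mulmxA vC.
have m1n : (m1 < n)%N by rewrite -ltnS -mn addSn addnS !ltnS leq_addr.
have m2n : (m2 < n)%N by rewrite -ltnS -mn addSn addnS !ltnS leq_addl.
rewrite vE.
have HK m := polyfun_subalgebra k r m; pose sum := tuple_sum (r := r) U U' W W'.
(* Density is used in one summand at a time: first [a] is replaced by a polynomial tuple with [b]
   fixed, then [b] with [a'] fixed. *)
apply: (commuting_gl_dense (f := fun a => f (sum a b)) (IH _ m1n))
  => // [|a' a'E].
  apply: (polyfun_tuple_sum U U' W W' (a := id) (b := fun=> b) (HK _)) => //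
    i x y.
    exact: polyfun_entry.
  by case: (HK m1.+1).
apply: (commuting_gl_dense (f := fun b => f (sum a' b)) (IH _ m2n))
  => // [|b' b'E].
  apply: (polyfun_tuple_sum U U' W W' (a := fun=> a') (b := id) (HK _)) => //
    i x y.
    by case: (HK m2.+1).
  exact: polyfun_entry.
by apply/f0/polynomial_tuple_sum.
Qed.

End Density.

Theorem theorem3p2p2 (k : closedFieldType) (r n : nat) (hr : (2 <= r)%N)
    (hn : (1 <= n)%N)
    (hlt : forall m : nat, (1 <= m < n)%N ->
       zariski_irreducible (commuting_variety r (gl k m)))
    (hnil : zariski_irreducible (commuting_variety r (nilpotent_cone k n))) :
  zariski_irreducible (commuting_variety r (gl k n)).
Proof.
case: n hn hlt hnil => // n _ hlt hnil.
have i0 : 'I_r by apply: Ordinal (ltnW hr).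
have dense f := @commuting_gl_dense_step k r i0 n f (fun m => hlt m.+1) hnil.
apply/zariski_irreducible_polyfunP; split.
  by exists [ffun _ => 0]; apply/commuting_glP => i j; rewrite !ffunE.
move=> f g pf pg fg0.
(* Polynomial tuples commute, so [f * g] vanishes on them; hence [f] or [g] does, and density
   extends this to the whole variety. *)
have [v [A [q vE]]|f0|g0] := polynomial_tuple_ideal_prime pf pg.
- apply/fg0/commuting_glP => i j; rewrite !vE.
  by apply: comm_mx_horner; apply: comm_horner_mx.
- by left; apply: dense.
- by right; apply: dense.
Qed.
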